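(* For every $\epsilon\in(0,1)$ there is a constant $C=C(\epsilon)$ such that the following holds. Let $G$ be a cyclic group of odd prime order $|G|$, let $x$ be a generator of $G$, let $y\in G$, and let $g_0\in G$ be an arbitrary fixed starting element. Let $F:G\to G$ be the random iterating function of the idealized Pollard Rho algorithm for $(G,x,y)$, and let $g_{i+1}=F(g_i)$ for $i\ge 0$. Then, with probability at least $1-\epsilon$ (over the random partition defining $F$), a collision occurs within the first $C\sqrt{|G|\,\log|G|\,\log\log|G|}$ steps, i.e. there exist integers $0\le i<j\le C\sqrt{|G|\,\log|G|\,\log\log|G|}$ with $g_i=g_j$.
   Context: Idealized Pollard Rho algorithm: each element $g\in G$ is assigned, independently and uniformly at random, to exactly one of three sets $S_1,S_2,S_3$ (each with probability $1/3$), forming a random partition of $G$. The iterating function is $F(g)=gx$ if $g\in S_1$, $F(g)=g^2$ if $g\in S_2$, and $F(g)=gy$ if $g\in S_3$. The starting element $g_0$ does not depend on the random partition. A collision is the event that the walk visits a group element it has already visited. Logarithms are natural. *)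

(* Defs.v *)
From HB Require Import structures.
From mathcomp Require Import all_boot all_order all_algebra all_fingroup.
From mathcomp Require Import all_solvable.
From mathcomp Require Import boolp reals exp.

Set Implicit Arguments.
Unset Strict Implicit.
Unset Printing Implicit Defensive.

Import Order.TTheory GRing.Theory Num.Theory.

(* A partition of the group into S_1, S_2, S_3 is encoded by its labelling:
   [s g] is 0, 1 or 2 when g lies in S_1, S_2 or S_3, respectively. *)
Definition labelling (gT : finGroupType) := {ffun gT -> 'I_3}.

Definition rho_step (gT : finGroupType) (x y : gT) (s : labelling gT)
    (g : gT) : gT :=
  match nat_of_ord (s g) with
  | 0 => (g * x)%g
  | 1 => (g ^+ 2)%g
  | _ => (g * y)%g
  end.

Definition rho_walk (gT : finGroupType) (x y : gT) (s : labelling gT)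
    (g0 : gT) (i : nat) : gT :=
  iter i (rho_step x y s) g0.

Local Open Scope ring_scope.

(* Product measure: the labels of the elements are independent, each uniform
   on three values, so every labelling has weight \prod_g 1/3. *)
Definition labelling_prob (R : realType) (gT : finGroupType)
    (E : labelling gT -> Prop) : R :=
  \sum_(s : labelling gT | `[< E s >]) \prod_(g : gT) (3%:R)^-1.

Definition collision_within (R : realType) (gT : finGroupType) (x y g0 : gT)
    (B : R) (s : labelling gT) : Prop :=
  exists i j : nat,
    [/\ (i < j)%N, j%:R <= B & rho_walk x y s g0 i = rho_walk x y s g0 j].

(* Main.v *)
(* Let [p = #|gT|]. The label of an element is revealed only when the walk
   first visits it, so up to the first collision the walk moves by independent
   uniform labels. In exponents modulo [p] it does [X -> X + 1], [X -> X + a]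
   or [X -> 2 X]. Observed at the [m]-th doubling, its law has at frequency [j]
   a Fourier coefficient of modulus at most the product over [k <= m] of
   [1 / (2 - cos (2 pi 2^k j / p))], and a factor is at most [1/2] whenever
   two consecutive binary digits of [j / p] (those of ranks [k + 1] and [k + 2])
   differ. Cut the doublings into [r] windows of [t] of them, [t = log2 p]:
   in every window, a nonzero [j] shows a nonconstant digit string, and distinct
   [j] show distinct strings. Hence the sum over [j] of these products is
   [O(r t 2^-r)], which is small for [r] of order [log log p]: every point has
   probability at least [1/(2p)] after [O(log p log log p)] steps.

   Once [N] points are visited, each block of that length [n] therefore
   collides with probability at least [N/(2p)]; take [k] blocks with
   [N = k n] and [k^2 n] of order [p / eps]. *)

Require Import Defs.
From HB Require Import structures.
From mathcomp Require Import all_boot all_order all_algebra all_fingroup.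
From mathcomp Require Import all_solvable.
From mathcomp Require Import boolp reals exp.
From mathcomp Require Import sequences trigo complex.
From mathcomp Require Import zify ring lra.

Set Implicit Arguments.
Unset Strict Implicit.
Unset Printing Implicit Defensive.

Import Order.TTheory GRing.Theory Num.Theory.
Local Open Scope ring_scope.

(** * Binary digits of [x / p] *)

Lemma sumr_double (V : nmodType) (n : nat) (F : nat -> V) :
  \sum_(0 <= c < n.*2) F c = \sum_(0 <= c < n) (F c.*2 + F c.*2.+1).
Proof.
elim: n => [|n IHn]; first by rewrite !big_nil.
by rewrite doubleS !big_nat_recr //= IHn addrA.
Qed.

(** The two lowest binary digits of [c] differ. At [c = 4 * x %/ p] this puts the fractional part of
    [x / p] in [[1/4, 3/4)]. *)
Definition bitflip (c : nat) : bool := (c %% 4 == 1)%N || (c %% 4 == 2)%N.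

Definition flip_weight (R : realDomainType) (a : R) (c : nat) : R :=
  if bitflip c then a else 1.

(** This is [a] to the number of unequal adjacent pairs among the [t + 1] lowest digits of [c]. *)
Definition bits_weight (R : realDomainType) (a : R) (t c : nat) : R :=
  \prod_(0 <= j < t) flip_weight a (c %/ 2 ^ j).

Lemma bits_weightS (R : realDomainType) (a : R) t c :
  bits_weight a t.+1 c = flip_weight a c * bits_weight a t (c %/ 2).
Proof.
rewrite /bits_weight big_nat_recl //= expn0 divn1; congr (_ * _).
by apply: eq_bigr => j _; rewrite -divnMA expnS.
Qed.

(** Exactly one of [c.*2] and [c.*2.+1] ends in a digit unlike that of [c], so each appended digit
    contributes [1 + a]; the factor 2 counts the leading digit. *)
Lemma sum_bits_weight (R : realDomainType) (a : R) t :
  \sum_(0 <= c < 2 ^ t.+1) bits_weight a t c = 2 * (1 + a) ^+ t.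
Proof.
elim: t => [|t IHt].
  by rewrite expr0 mulr1 /bits_weight !big_nat_recr //= !big_nil add0r.
rewrite expnS mul2n sumr_double exprS mulrCA -IHt big_distrr /=.
apply: eq_bigr => c _; rewrite !bits_weightS.
have -> : (c.*2 %/ 2 = c)%N by lia.
have -> : (c.*2.+1 %/ 2 = c)%N by lia.
rewrite -mulrDl; congr (_ * _); rewrite /flip_weight /bitflip.
case/boolP: (odd c) => oc.
  have -> : (c.*2 %% 4 = 2)%N by lia.
  have -> : (c.*2.+1 %% 4 = 3)%N by lia.
  by rewrite /= addrC.
have -> : (c.*2 %% 4 = 0)%N by lia.
by have -> : (c.*2.+1 %% 4 = 1)%N by lia.
Qed.

Lemma flip_weight_ge0 (R : realDomainType) (a : R) c : 0 <= a ->
  0 <= flip_weight a c.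
Proof. by rewrite /flip_weight; case: ifP. Qed.

Lemma bits_weight_ge0 (R : realDomainType) (a : R) t c : 0 <= a ->
  0 <= bits_weight a t c.
Proof. by move=> a0; apply: prodr_ge0 => j _; exact: flip_weight_ge0. Qed.

Lemma bits_weight0 (R : realDomainType) (a : R) t : bits_weight a t 0 = 1.
Proof. by rewrite /bits_weight big1// => j _; rewrite div0n. Qed.

Lemma bits_weight_max (R : realDomainType) (a : R) t :
  bits_weight a t (2 ^ t.+1).-1 = 1.
Proof.
elim: t => [|t IHt]; first by rewrite /bits_weight big_nil.
have e2 : (0 < 2 ^ t)%N by rewrite expn_gt0.
rewrite bits_weightS.
have -> : ((2 ^ t.+2).-1 %/ 2 = (2 ^ t.+1).-1)%N by rewrite !expnS; lia.
rewrite IHt mulr1 /flip_weight /bitflip.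
have -> : ((2 ^ t.+2).-1 %% 4 = 3)%N by rewrite !expnS; lia.
by [].
Qed.

(** The two omitted ends are the constant digit strings, each of weight 1. *)
Lemma sum_bits_weight_inner (R : realDomainType) (a : R) t :
  \sum_(1 <= c < (2 ^ t.+1).-1) bits_weight a t c = 2 * (1 + a) ^+ t - 2.
Proof.
rewrite -sum_bits_weight; have := bits_weight_max a t.
have : (2 <= 2 ^ t.+1)%N by rewrite expnS leq_pmulr ?expn_gt0.
case: (2 ^ t.+1)%N => [|[|N]] //= _ maxE.
rewrite [in RHS]big_nat_recr //= [in RHS]big_nat_recl //= bits_weight0 maxE.
by rewrite big_add1 /=; ring.
Qed.

Lemma expr1D_le (R : realFieldType) (a : R) t : 0 <= a -> 2 * t%:R * a <= 1 ->
  (1 + a) ^+ t <= 1 + 2 * t%:R * a.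
Proof.
move=> a0; elim: t => [|t IHt] ta; first by rewrite expr0; lra.
have ta' : 2 * t%:R * a <= 1.
  by apply: le_trans ta; rewrite ler_wpM2r// -natr1; lra.
rewrite exprSr; apply: le_trans (_ : (1 + 2 * t%:R * a) * (1 + a) <= _).
  by apply: ler_wpM2r; [lra|exact: IHt].
by rewrite -natr1; nra.
Qed.

(* The base-2 digits of [x / p] are read off the integer [2 ^ t.+1 * x %/ p]. *)
Lemma bits_weight_orbit (R : realDomainType) (a : R) (p t x : nat) :
  (0 < p)%N ->
  \prod_(0 <= k < t) flip_weight a (4 * (2 ^ k * x) %/ p) =
  bits_weight a t (2 ^ t.+1 * x %/ p).
Proof.
(* Successive doublings read the digits from the top, [bits_weight] from the bottom, hence the
   reversal. *)
move=> p0; rewrite /bits_weight big_nat_rev /= add0n.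
apply: eq_big_nat => j /andP[_ jt]; congr (flip_weight a _).
rewrite -divnMA [in RHS]mulnC.
rewrite -(@divnMl (2 ^ j) (4 * (2 ^ (t - j.+1) * x)) p) ?expn_gt0 //.
congr (_ %/ _)%N; last by rewrite mulnC.
rewrite (_ : t.+1 = 2 + (j + (t - j.+1)))%N; last by lia.
by rewrite !expnD; ring.
Qed.

Lemma flip_weight_modn (R : realDomainType) (a : R) (p x : nat) : (0 < p)%N ->
  flip_weight a (4 * (x %% p) %/ p) = flip_weight a (4 * x %/ p).
Proof.
move=> p0; rewrite {2}(divn_eq x p) /flip_weight /bitflip.
by rewrite mulnDr mulnA divnMDl// -modnDml modnMr.
Qed.

Lemma ler_sum_sub_uniq (R : numDomainType) (T : eqType) (s1 s2 : seq T)
    (F : T -> R) : uniq s1 -> uniq s2 -> {subset s1 <= s2} ->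
  (forall i, 0 <= F i) -> \sum_(i <- s1) F i <= \sum_(i <- s2) F i.
Proof.
move=> u1 u2 s12 F0; rewrite [leRHS](bigID (mem s1)) /=.
rewrite -[\sum_(i <- s2 | i \in s1) _]big_filter [X in _ <= X + _](perm_big s1); last first.
  apply: uniq_perm; rewrite ?filter_uniq// => i.
  by rewrite mem_filter andb_idr// => /s12.
by rewrite lerDl sumr_ge0.
Qed.

(** The product is at most the [r]-th power of its largest factor, which is one of the summands.
    Windows can then be summed separately. *)
Lemma ler_prod_sum_exp (R : realDomainType) (r : nat) (F : nat -> R) :
  (0 < r)%N -> (forall i, 0 <= F i) ->
  \prod_(0 <= i < r) F i <= \sum_(0 <= i < r) F i ^+ r.
Proof.
case: r => // r _ F0; rewrite !big_mkord.
case: (@arg_maxP _ _ _ (@ord0 r) xpredT (fun i => F i) isT) => j _ Fj.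
apply: (@le_trans _ _ (F j ^+ r.+1)).
  have -> : F j ^+ r.+1 = \prod_(i < r.+1) F j by rewrite prodr_const card_ord.
  by apply: ler_prod => i _; apply/andP; split; [exact: F0|exact: Fj].
by rewrite (bigD1 j) //= lerDl sumr_ge0// => i _; rewrite exprn_ge0.
Qed.

Lemma eq_modn_2pow (p s i j : nat) : odd p -> (i < p)%N -> (j < p)%N ->
  (2 ^ s * i = 2 ^ s * j %[mod p])%N -> i = j.
Proof.
move=> op; wlog ij : i j / (i <= j)%N.
  by move=> H ip jp E; case/orP: (leq_total i j) => ?; [|symmetry]; apply: H.
move=> ip jp /eqP; rewrite eq_sym eqn_mod_dvd ?leq_mul// -mulnBr Gauss_dvdr.
  case: (posnP (j - i)) => [|ji /(dvdn_leq ji)]; lia.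
by rewrite coprimeXr// coprimen2.
Qed.

(** Multiplication by [2 ^ s] permutes the nonzero residues, and as [p < 2 ^ t.+1] their first
    [t + 1] binary digits form distinct nonconstant strings. *)
Lemma sum_block_le (R : realFieldType) (a : R) (p t s : nat) :
  odd p -> (p < 2 ^ t.+1)%N -> 0 <= a ->
  \sum_(1 <= x < p) \prod_(0 <= k < t)
     flip_weight a (4 * (2 ^ k * (2 ^ s * x)) %/ p) <= 2 * (1 + a) ^+ t - 2.
Proof.
move=> op pt a0; have p0 : (0 < p)%N by case: p op {pt}.
pose y x := (2 ^ s * x %% p)%N; pose h x := (2 ^ t.+1 * y x %/ p)%N.
have yp x : (y x < p)%N by rewrite ltn_mod.
have y0 x : (0 < x < p)%N -> (0 < y x)%N.
  case/andP=> x0 xp; rewrite lt0n; apply/eqP => yx0.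
  have := @eq_modn_2pow p s x 0 op xp p0.
  by rewrite muln0 mod0n => /(_ yx0) x00; rewrite x00 in x0.
have -> : \sum_(1 <= x < p) \prod_(0 <= k < t)
     flip_weight a (4 * (2 ^ k * (2 ^ s * x)) %/ p) =
   \sum_(c <- map h (index_iota 1 p)) bits_weight a t c.
  rewrite big_map; apply: eq_bigr => x _; rewrite -bits_weight_orbit//.
  apply: eq_bigr => k _; rewrite -flip_weight_modn// -[in RHS]flip_weight_modn//.
  by rewrite modnMmr.
rewrite -sum_bits_weight_inner; apply: ler_sum_sub_uniq; rewrite ?iota_uniq//.
- rewrite map_inj_in_uniq ?iota_uniq// => i j.
  rewrite !mem_index_iota => /andP[_ ip] /andP[_ jp] hij.
  apply: (@eq_modn_2pow p s) => //; rewrite -/(y i) -/(y j).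
  (* Equal quotients put two multiples of [2 ^ t.+1] at distance less than [p], so they coincide. *)
  have := divn_eq (2 ^ t.+1 * y i) p; have := divn_eq (2 ^ t.+1 * y j) p.
  rewrite -/(h i) -/(h j) hij.
  have := ltn_pmod (2 ^ t.+1 * y i) p0; have := ltn_pmod (2 ^ t.+1 * y j) p0.
  by nia.
- move=> c /mapP[x]; rewrite !mem_index_iota => xp ->.
  have := y0 _ xp; have := yp x.
  have := divn_eq (2 ^ t.+1 * y x) p; have := ltn_pmod (2 ^ t.+1 * y x) p0.
  by rewrite -/(h x) => *; apply/andP; split; nia.
- by move=> c; exact: bits_weight_ge0.
Qed.

(** The [r]-th power turns the weight [1/2] of a flip into [2^-r]; window [b] is then [sum_block_le]
    at [s = (b * t).+1]. *)
Lemma sum_orbit_le (R : realFieldType) (p t r : nat) :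
  odd p -> (p < 2 ^ t.+1)%N -> (0 < r)%N ->
  \sum_(1 <= x < p) \prod_(0 <= k < r * t)
     flip_weight (2^-1 : R) (4 * (2 ^ k.+1 * x) %/ p)
  <= r%:R * (2 * (1 + 2^-1 ^+ r) ^+ t - 2).
Proof.
move=> op pt r0; have h0 : 0 <= 2^-1 :> R by rewrite invr_ge0.
apply: (@le_trans _ _ (\sum_(1 <= x < p) \sum_(0 <= b < r)
    \prod_(0 <= k < t)
       flip_weight (2^-1 ^+ r : R) (4 * (2 ^ k * (2 ^ (b * t).+1 * x)) %/ p))).
  apply: ler_sum => x _; rewrite big_nat_mul.
  apply: le_trans (ler_prod_sum_exp r0 _) _.
    by move=> b; apply: prodr_ge0 => k _; exact: flip_weight_ge0.
  apply: ler_sum => b _; rewrite -prodrXl -{1}[(b * t)%N]add0n big_addn.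
  rewrite mulSn addnK le_eqVlt; apply/orP; left; apply/eqP.
  apply: eq_bigr => k _.
  have -> : (2 ^ k * (2 ^ (b * t).+1 * x) = 2 ^ (k + b * t).+1 * x)%N.
    by rewrite mulnA -expnD addnS.
  by rewrite /flip_weight; case: ifP; rewrite ?expr1n.
rewrite exchange_big /=.
apply: le_trans (ler_sum _ (fun b _ => sum_block_le _ op pt _)) _.
  by rewrite exprn_ge0.
by rewrite sumr_const_nat subn0 -[leLHS]mulr_natl.
Qed.

(** * The walk driven by fresh labels *)

Lemma labelling_prob_total (R : realType) (gT : finGroupType) :
  \sum_(s : labelling gT) \prod_(g : gT) (3%:R)^-1 = 1 :> R.
Proof.
rewrite sumr_const prodr_const card_ffun card_ord exprVn.
rewrite (eq_card (B := gT)) //.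
by rewrite -[LHS]mulr_natr natrX mulVf// expf_neq0// pnatr_eq0.
Qed.

(* Shifting the label of [u] by a uniform element of Z/3 preserves the uniform
   measure on labellings. *)
Lemma sum_labelling_resample (V : zmodType) (gT : finGroupType) (u : gT)
    (F : 'I_3 -> labelling gT -> V) :
  (forall l (s s' : labelling gT), (forall g, g != u -> s g = s' g) -> F l s = F l s') ->
  (\sum_(s : labelling gT) F (s u) s) *+ 3 =
  \sum_(l : 'I_3) \sum_(s : labelling gT) F l s.
Proof.
move=> Fu; pose h c (s : labelling gT) : labelling gT :=
  [ffun g => if g == u then s g + c else s g].
have hK c : cancel (h c) (h (- c)).
  by move=> s; apply/ffunP => g; rewrite !ffunE; case: eqP => // _; rewrite addrK.
have hE c : \sum_(s : labelling gT) F (s u) s =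
            \sum_(s : labelling gT) F (s u + c) s.
  rewrite (reindex (h c)) /=; last first.
    apply: onW_bij; exists (h (- c)); first exact: hK.
    by move=> s; have := hK (- c) s; rewrite opprK.
  apply: eq_bigr => s _; rewrite {1}/h ffunE eqxx; apply: Fu => g gu.
  by rewrite ffunE (negbTE gu).
have -> : (\sum_(s : labelling gT) F (s u) s) *+ 3 =
    \sum_(c : 'I_3) \sum_(s : labelling gT) F (s u) s.
  by rewrite sumr_const card_ord.
rewrite (eq_bigr _ (fun c _ => hE c)) exchange_big [RHS]exchange_big /=.
apply: eq_bigr => s _; rewrite [RHS](reindex_inj (addrI (s u))).
by apply: eq_bigr.
Qed.

Fixpoint walk_fresh (gT : finGroupType) (x y : gT) (n : nat) (S : {set gT})
    (u : gT) (s : labelling gT) : bool :=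
  (u \notin S) &&
  (if n is n'.+1 then walk_fresh x y n' (u |: S) (rho_step x y s u) s else true).

(** The recursion stops at a point of [S] before reading its label; this is the independence that
    resampling needs. *)
Lemma walk_fresh_eq (gT : finGroupType) (x y : gT) n (S : {set gT}) u v
    (s s' : labelling gT) :
  v \in S -> (forall g, g != v -> s g = s' g) ->
  walk_fresh x y n S u s = walk_fresh x y n S u s'.
Proof.
elim: n S u => [//|n IHn] S u vS ss' /=; case: (boolP (u \in S)) => //= uS.
have uv : u != v by apply: contraNneq uS => ->.
by rewrite /rho_step (ss' _ uv); apply: IHn => //; rewrite inE vS orbT.
Qed.

Lemma walk_freshPn (gT : finGroupType) (x y : gT) n (S : {set gT}) u s :
  ~~ walk_fresh x y n S u s ->
  (exists2 j, (j <= n)%N & rho_walk x y s u j \in S) \/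
  (exists i j, [/\ (i < j)%N, (j <= n)%N &
                 rho_walk x y s u i = rho_walk x y s u j]).
Proof.
have walkS g i : rho_walk x y s g i.+1 = rho_walk x y s (rho_step x y s g) i.
  by rewrite /rho_walk iterSr.
elim: n S u => [|n IHn] S u /=.
  by rewrite andbT negbK => uS; left; exists 0%N.
case: (boolP (u \in S)) => /= [uS _|uS]; first by left; exists 0%N.
case/IHn=> [[j jn]|[i [j [ij jn wij]]]]; last first.
  by right; exists i.+1, j.+1; rewrite !walkS.
rewrite -walkS in_setU1 => /orP[/eqP wu|wS]; last by left; exists j.+1.
by right; exists 0%N, j.+1; rewrite wu.
Qed.

Fixpoint fresh_prob (R : fieldType) (gT : finGroupType) (x y : gT) (n : nat)
    (S : {set gT}) (u : gT) : R :=
  if u \in S then 0 else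
  if n is n'.+1 then
    3^-1 * (fresh_prob R x y n' (u |: S) (u * x)%g +
            fresh_prob R x y n' (u |: S) (u ^+ 2)%g +
            fresh_prob R x y n' (u |: S) (u * y)%g)
  else 1.

(* Deferred decisions: the label of an element is independent of the walk until
   the walk reaches it. *)
Lemma fresh_probE (R : realType) (gT : finGroupType) (x y : gT) n
    (S : {set gT}) u :
  \sum_(s | walk_fresh x y n S u s) \prod_(g : gT) (3%:R)^-1 =
  fresh_prob R x y n S u.
Proof.
elim: n S u => [|n IHn] S u /=.
  case: (boolP (u \in S)) => uS /=; first by rewrite big_pred0_eq.
  exact: labelling_prob_total.
case: (boolP (u \in S)) => uS /=; first by rewrite big_pred0_eq.
pose st (l : 'I_3) : gT :=
  match nat_of_ord l with 0%N => (u * x)%g | 1%N => (u ^+ 2)%g | _ => (u * y)%g end.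
pose F l (s : labelling gT) : R := if walk_fresh x y n (u |: S) (st l) s
  then \prod_(g : gT) (3%:R)^-1 else 0.
have -> : \sum_(s : labelling gT |
      walk_fresh x y n (u |: S) (rho_step x y s u) s) \prod_(g : gT) 3^-1 =
    \sum_(s : labelling gT) F (s u) s.
  by rewrite big_mkcond.
have := @sum_labelling_resample R gT u F.
have Fu l (s s' : labelling gT) : (forall g, g != u -> s g = s' g) -> F l s = F l s'.
  by rewrite /F => ss'; rewrite (walk_fresh_eq _ _ _ _ _ ss')// setU11.
move=> /(_ Fu) E3; apply: (@mulIf R 3); first by rewrite pnatr_eq0.
rewrite mulr_natr E3 mulrAC mulVf ?mul1r ?pnatr_eq0// !big_ord_recl big_ord0.
by rewrite addr0 -!IHn -!big_mkcond /= addrA.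
Qed.

Lemma collision_within_prob_ge (R : realType) (gT : finGroupType) (x y g0 : gT)
    (B : R) n : n%:R <= B ->
  1 - fresh_prob R x y n set0 g0 <=
  labelling_prob R (collision_within x y g0 B).
Proof.
move=> nB; have := labelling_prob_total R gT.
rewrite (bigID (walk_fresh x y n set0 g0)) /= fresh_probE.
move=> /eqP; rewrite addrC eq_sym -subr_eq => /eqP ->.
rewrite /labelling_prob [leLHS]big_mkcond [leRHS]big_mkcond; apply: ler_sum => s _.
have w0 : 0 <= \prod_(g : gT) (3%:R)^-1 :> R.
  by apply: prodr_ge0 => g _; rewrite invr_ge0.
case: (boolP (walk_fresh _ _ _ _ _ _)) => fr /=; first by case: ifP.
case: asboolP => // -[]; have [[j _]|[i [j [ij jn wij]]]] := walk_freshPn fr.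
  by rewrite inE.
by exists i, j; split=> //; apply: le_trans nB; rewrite ler_nat.
Qed.

(* With [T] the time of the [m]-th doubling in the walk from [u] driven by
   independent uniform labels, [stopped_mean m n f u] is the expectation of [f]
   at the position at time [T], restricted to the event that [T <= n]. *)
Fixpoint stopped_mean (R : fieldType) (gT : finGroupType) (x y : gT)
    (m n : nat) (f : gT -> R) (u : gT) : R :=
  if n is n'.+1 then
    if m is m'.+1 then
      3^-1 * (stopped_mean x y m n' f (u * x)%g +
              stopped_mean x y m' n' f (u ^+ 2)%g +
              stopped_mean x y m n' f (u * y)%g)
    else f u
  else if m is 0 then f u else 0.

Lemma stopped_mean0 (R : fieldType) (gT : finGroupType) (x y : gT) n
    (f : gT -> R) u : stopped_mean x y 0 n f u = f u.
Proof. by case: n. Qed.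

Lemma rmorph_stopped_mean (R S : fieldType) (phi : {rmorphism R -> S})
    (gT : finGroupType) (x y : gT) m n (f : gT -> R) u :
  phi (stopped_mean x y m n f u) = stopped_mean x y m n (phi \o f) u.
Proof.
elim: n m u => [|n IHn] [|m] u //=; first by rewrite rmorph0.
by rewrite rmorphM fmorphV rmorph_nat !rmorphD /= !IHn.
Qed.

Lemma stopped_mean_sum (R : fieldType) (gT : finGroupType) (x y : gT)
    (I : Type) (r : seq I) (c : I -> R) (f : I -> gT -> R) m n u :
  stopped_mean x y m n (fun g => \sum_(i <- r) c i * f i g) u =
  \sum_(i <- r) c i * stopped_mean x y m n (f i) u.
Proof.
elim: n m u => [|n IHn] [|m] u //=.
  by rewrite big1// => i _; rewrite mulr0.
rewrite !IHn -!big_split big_distrr /=.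
by apply: eq_bigr => i _; rewrite -!mulrDr mulrCA.
Qed.

Lemma ler_stopped_mean (R : numFieldType) (gT : finGroupType) (x y : gT) m n
    (f g : gT -> R) u : (forall v, f v <= g v) ->
  stopped_mean x y m n f u <= stopped_mean x y m n g u.
Proof.
move=> fg; elim: n m u => [|n IHn] [|m] u //=.
by rewrite ler_wpM2l ?invr_ge0// !lerD.
Qed.

Lemma stopped_mean_le1 (R : numFieldType) (gT : finGroupType) (x y : gT) m n
    (f : gT -> R) u : (forall v, f v <= 1) -> stopped_mean x y m n f u <= 1.
Proof.
move=> f1; elim: n m u => [|n IHn] [|m] u //=.
by rewrite ler_pdivrMl// (_ : 3 * 1 = 1 + 1 + 1); [do 2 apply: lerD => //|ring].
Qed.

Lemma eq_stopped_mean (R : fieldType) (gT : finGroupType) (x y : gT) m n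
    (f g : gT -> R) u : f =1 g ->
  stopped_mean x y m n f u = stopped_mean x y m n g u.
Proof.
by move=> fg; elim: n m u => [|n IHn] [|m] u /=; rewrite ?fg ?IHn.
Qed.

(** * From hitting probabilities to the probability of no collision *)

Definition set_indic (R : nzRingType) (gT : finGroupType) (S : {set gT})
    (g : gT) : R := (g \in S)%:R.

(** Every step of a fresh walk enlarges the visited set, so after [n] steps the bound [b]
    applies. *)
Lemma fresh_prob_prefix (R : numFieldType) (gT : finGroupType) (x y : gT)
    (M N : nat) (b : R) :
  0 <= b ->
  (forall (S : {set gT}) v, (N <= #|S|)%N -> fresh_prob R x y M S v <= b) ->
  forall n (S : {set gT}) u, (N <= #|S| + n)%N ->
    fresh_prob R x y (n + M) S u <= b.
Proof.
move=> b0 Mb; elim=> [|n IHn] S u; first by rewrite addn0; exact: Mb.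
rewrite addnS addSn => NS /=; case: ifPn => // uS.
have IH v : fresh_prob R x y (n + M) (u |: S) v <= b.
  by apply: IHn; rewrite cardsU1 uS; lia.
by rewrite ler_pdivrMl// (_ : 3 * b = b + b + b); [do 2 apply: lerD => //|ring].
Qed.

(** Until it meets a visited point, the walk moves as if driven by independent labels. Being in [S]
    at the [m]-th doubling ends freshness; only the complementary mass goes on to face the bound
    [b]. *)
Lemma fresh_prob_block (R : numFieldType) (gT : finGroupType) (x y : gT)
    (M N m n : nat) (b : R) (S : {set gT}) u :
  0 <= b ->
  (forall (S : {set gT}) v, (N <= #|S|)%N -> fresh_prob R x y M S v <= b) ->
  (N <= #|S|)%N ->
  fresh_prob R x y (n + M) S u <=
    (1 - stopped_mean x y m n (set_indic R S) u) * b.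
Proof.
move=> b0 Mb; elim: n m S u => [|n IHn] m S u NS.
  case: m => [|m] /=; last by rewrite subr0 mul1r; exact: Mb.
  rewrite /set_indic; case: (boolP (u \in S)) => uS.
    rewrite subrr mul0r; case: M Mb => [|M] _ /=; by rewrite uS.
  by rewrite subr0 mul1r; exact: Mb.
case: (boolP (u \in S)) => uS.
  rewrite addSn [leLHS]/= uS mulr_ge0// subr_ge0; apply: stopped_mean_le1 => v.
  by rewrite /set_indic lern1 leq_b1.
case: m => [|m].
  rewrite stopped_mean0 /set_indic (negbTE uS) subr0 mul1r.
  by apply: (fresh_prob_prefix b0 Mb); lia.
rewrite addSn [leLHS]/= (negbTE uS).
have NS' : (N <= #|u |: S|)%N by rewrite cardsU1 uS; lia.
have IH k v : fresh_prob R x y (n + M) (u |: S) v <=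
    (1 - stopped_mean x y k n (set_indic R S) v) * b.
  (* Passing from [u |: S] back to [S] only lowers the hitting mean. *)
  apply: le_trans (IHn k _ _ NS') _; rewrite ler_wpM2r// lerD2l lerN2.
  apply: ler_stopped_mean => w; rewrite /set_indic ler_nat inE.
  by case: (w \in S); rewrite ?orbT.
rewrite ler_pdivrMl//=.
apply: le_trans (lerD (lerD (IH m.+1 _) (IH m _)) (IH m.+1 _)) _.
by rewrite le_eqVlt; apply/orP; left; apply/eqP; field.
Qed.

(** Each block costs a factor [1 - h], and [(1 - h) / (1 + k h) <= 1 / (1 + (k + 1) h)]. This form
    is easily inverted when [k] is chosen. *)
Lemma fresh_prob_iter (R : numFieldType) (gT : finGroupType) (x y : gT)
    (N m n : nat) (h : R) :
  0 <= h ->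
  (forall (S : {set gT}) u, (N <= #|S|)%N ->
     h <= stopped_mean x y m n (set_indic R S) u) ->
  forall k (S : {set gT}) u, (N <= #|S|)%N ->
    fresh_prob R x y (k * n) S u <= (1 + k%:R * h)^-1.
Proof.
move=> h0 hS; elim=> [|k IHk] S u NS.
  by rewrite mul0r addr0 invr1 /=; case: ifP.
have pos j : 0 < 1 + j%:R * h by rewrite ltr_pwDl// mulr_ge0.
have b0 : 0 <= (1 + k%:R * h)^-1 by rewrite invr_ge0 ltW.
rewrite mulSn; apply: le_trans (fresh_prob_block m n u b0 IHk NS) _.
apply: (@le_trans _ _ ((1 - h) * (1 + k%:R * h)^-1)).
  by rewrite ler_wpM2r// lerD2l lerN2 hS.
rewrite ler_pdivrMr// ler_pdivlMl// -natr1 -subr_ge0.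
rewrite (_ : _ - _ = (k%:R + 1) * h ^+ 2); last by ring.
by rewrite mulr_ge0// ?exprn_ge0// addr_ge0.
Qed.

(** * Characters *)

Definition cis (R : realType) (t : R) : R[i] := (cos t +i* sin t)%C.

Lemma cisD (R : realType) (s t : R) : cis (s + t) = cis s * cis t.
Proof.
by rewrite /cis cosD sinD; simpc; congr (_ +i* _)%C; rewrite addrC// mulrC.
Qed.

Lemma cisMn (R : realType) (t : R) n : cis (t *+ n) = cis t ^+ n.
Proof.
elim: n => [|n IHn]; last by rewrite mulrS exprS cisD IHn.
by rewrite mulr0n expr0 /cis cos0 sin0.
Qed.

Lemma cis2pi (R : realType) : cis (pi *+ 2 : R) = 1.
Proof. by rewrite /cis cos2pi sin2pi. Qed.

Definition cis_root (R : realType) (p : nat) : R[i] := cis (pi *+ 2 / p%:R).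

Lemma cis_rootX (R : realType) (p : nat) : (0 < p)%N -> cis_root R p ^+ p = 1.
Proof.
move=> p0; rewrite -cisMn -[_ *+ p]mulr_natr divfK ?cis2pi//.
by rewrite pnatr_eq0 -lt0n.
Qed.

(** The order divides the prime [p]. Order 1 would give cosine 1 at [2 pi / p], which lies strictly
    between 0 and [pi] since [p >= 3]. *)
Lemma prim_cis_root (R : realType) (p : nat) : prime p -> odd p ->
  p.-primitive_root (cis_root R p).
Proof.
move=> pp op; have p0 := prime_gt0 pp; have p1 := prime_gt1 pp.
have [m pm mp] := prim_order_exists p0 (cis_rootX R p0).
case/orP: ((primeP pp).2 _ mp) => /eqP m1; last by rewrite m1 in pm.
have p3 : (2 < p)%N by case: p op p1 {pp p0 pm mp} => [|[|[|]]].
have := prim_expr_order pm; rewrite m1 expr1 => /(congr1 (@complex.Re R)) /= cos1.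
have pi0 := @pi_gt0 R; have pR : 0 < p%:R :> R by rewrite ltr0n.
set t : R := pi *+ 2 / p%:R in cos1.
have t0 : 0 < t by rewrite divr_gt0// mulrn_wgt0.
have tpi : t < pi by rewrite ltr_pdivrMr// -[_ *+ 2]mulr_natr ltr_pM2l// ltr_nat.
have t0' := ltW t0; have tpi' := ltW tpi; have pi0' := ltW pi0.
have := @ltr_cos R 0 t; rewrite !in_itv /= lexx t0' tpi' pi0' => /(_ isT isT).
by rewrite t0 cos1 cos0 ltxx.
Qed.

Lemma cos_bitflip_le0 (R : realType) (p j : nat) : (0 < p)%N ->
  bitflip (4 * j %/ p) -> cos (pi *+ 2 / p%:R *+ j : R) <= 0.
Proof.
move=> p0 jflip; pose i := (j %% p)%N; pose q := (j %/ p)%N.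
have jE : j = (q * p + i)%N := divn_eq j p.
have [ip1 ip2] : (p <= 4 * i)%N /\ (4 * i <= 3 * p)%N.
  move: jflip; rewrite jE mulnDr mulnA divnMDl// /bitflip -modnDml modnMr add0n.
  have ip : (i < p)%N by rewrite ltn_mod.
  have a4 : (4 * i %/ p < 4)%N by rewrite ltn_divLR// ltn_pmul2l.
  rewrite modn_small//.
  case/orP => /eqP aE; have := divn_eq (4 * i) p; rewrite aE;
    have := ltn_pmod (4 * i) p0; by lia.
have -> : pi *+ 2 / p%:R *+ j = pi *+ 2 / p%:R *+ i + pi *+ 2 *+ q :> R.
  rewrite jE addrC mulrnDr mulnC mulrnA; congr (_ *+ _ + _).
  by rewrite -[LHS]mulr_natr divfK// pnatr_eq0 -lt0n.
rewrite -[cos _]/(complex.Re (cis _)) cisD (cisMn _ q) cis2pi expr1n mulr1 /=.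
set t := _ *+ i; rewrite -oppr_ge0.
(* Shifted by [pi], the angle lies in [[-pi/2, pi/2]], where the cosine is nonnegative. *)
have <- : cos (t - pi) = - cos t by rewrite -[t in RHS](subrK pi) cosDpi opprK.
have pR : 0 < p%:R :> R by rewrite ltr0n.
have ip1R : p%:R <= 4 * i%:R :> R by rewrite -natrM ler_nat.
have ip2R : 4 * i%:R <= 3 * p%:R :> R by rewrite -!natrM ler_nat.
have tE : t * p%:R = pi * 2 * i%:R by rewrite /t; field; rewrite gt_eqF.
have pi0 := @pi_gt0 R.
apply: cos_ge0_pihalf; apply/andP; split.
  by rewrite -(ler_pM2r pR) mulrBl tE; nra.
by rewrite -(ler_pM2r pR) mulrBl tE; nra.
Qed.

(** The modulus of the denominator is at least its real part, from which [w] takes at most 1: this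
    leaves 1, or 2 when a flip makes the real part of the root nonpositive. *)
Lemma norm_cis_root_inv_le (R : realType) (p j : nat) (w : R[i]) :
  (0 < p)%N -> `|w| = 1 ->
  `|(3 - cis_root R p ^+ j - w)^-1| <= (flip_weight 2^-1 (4 * j %/ p))%:C%C.
Proof.
move=> p0 w1; set z := _ ^+ j.
have Rew : complex.Re w <= 1.
  apply: le_trans (ler_norm _) _; rewrite -lecR; apply: le_trans (normc_ge_Re w) _.
  by rewrite w1.
have Rez : complex.Re z = cos (pi *+ 2 / p%:R *+ j) by rewrite /z -cisMn.
have Re3 : complex.Re (3 - z - w) = 3 - complex.Re z - complex.Re w.
  by rewrite !raddfB.
pose f : R := (flip_weight 2^-1 (4 * j %/ p))^-1.
have f0 : 0 < f.
  by rewrite invr_gt0 /flip_weight; case: ifP => // _; rewrite invr_gt0.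
have fRe : f <= complex.Re (3 - z - w).
  rewrite Re3 /f /flip_weight; case: ifP => [jf|_].
    by rewrite invrK; have := cos_bitflip_le0 R p0 jf; rewrite -Rez; lra.
  by rewrite invr1; have := cos_le1 (pi *+ 2 / p%:R *+ j : R); rewrite -Rez; lra.
have fn : f%:C%C <= `|3 - z - w|.
  apply: le_trans (normc_ge_Re _); rewrite lecR.
  exact: le_trans fRe (ler_norm _).
have fC : 0 < f%:C%C by rewrite ltcR.
rewrite normfV -[flip_weight _ _]invrK -/f fmorphV.
by rewrite lef_pV2// posrE// (lt_le_trans fC fn).
Qed.

Lemma char_denom_norm (K : numFieldType) (z w : K) : `|z| = 1 -> `|w| = 1 ->
  1 <= `|3 - z - w|.
Proof.
move=> z1 w1; apply: le_trans (lerB_dist _ _); rewrite w1 lerBrDr.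
apply: le_trans (lerB_dist _ _); rewrite z1 normr_nat.
by rewrite (_ : 3 - 1 = 1 + 1) //; ring.
Qed.

(* For a character [chi], the walk at the [m]-th doubling has mean
   [chi u ^+ (2 ^ m)] times a product of Fourier coefficients
   [1 / (3 - chi x ^+ (2 ^ k) - chi y ^+ (2 ^ k))] of geometric sums; the
   truncation at time [n] costs at most [(5/4)^-n (E (5/4)^T)^m], where [T] is
   the waiting time for one doubling and [E (5/4)^T = 5/2]. *)
Lemma stopped_mean_char (K : numFieldType) (gT : finGroupType) (x y : gT)
    (chi : gT -> K) :
  (forall g h, chi (g * h)%g = chi g * chi h) -> (forall g, `|chi g| = 1) ->
  forall m n u,
  `|stopped_mean x y m n chi u - chi u ^+ (2 ^ m) *
     \prod_(0 <= k < m) (3 - chi x ^+ (2 ^ k.+1) - chi y ^+ (2 ^ k.+1))^-1|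
  <= (4 / 5) ^+ n * (5 / 2) ^+ m.
Proof.
move=> chiM chi1; pose D k := 3 - chi x ^+ (2 ^ k.+1) - chi y ^+ (2 ^ k.+1).
pose G m := \prod_(0 <= k < m) (D k)^-1.
have D1 k : 1 <= `|D k| by apply: char_denom_norm; rewrite normrX chi1 expr1n.
have D0 k : D k != 0 by rewrite -normr_gt0 (lt_le_trans ltr01 (D1 k)).
have GS m : G m.+1 = G m / D m by rewrite /G big_nat_recr.
have G1 m : `|G m| <= 1.
  rewrite /G normr_prod; apply: prodr_ile1 => k _.
  by rewrite normr_ge0 normfV invf_le1 ?normr_gt0 ?D0 ?D1.
have q0 : 0 <= 4 / 5 :> K by rewrite divr_ge0.
have r0 : 0 <= 5 / 2 :> K by rewrite divr_ge0.
have r1 : 1 <= 5 / 2 :> K by rewrite ler_pdivlMr// mul1r ler_nat.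
move=> m n u; rewrite -/(G m); elim: n m u => [|n IHn] [|m] u /=.
- by rewrite /G big_nil expn0 expr1 !mulr1 subrr normr0.
(* With a doubling still due at [n = 0] the mean is 0, and the whole product, of modulus at most 1,
   is the error. *)
- rewrite sub0r normrN normrM normrX chi1 expr1n !mul1r.
  by apply: le_trans (G1 _) _; exact: exprn_ege1.
- rewrite /G big_nil expn0 expr1 !mulr1 subrr normr0.
  by rewrite exprn_ge0.
set A := stopped_mean _ _ _ _ _ _; set B := stopped_mean _ _ _ _ _ _.
set E := stopped_mean _ _ _ _ _ _.
have IA := IHn m.+1 (u * x)%g; have IB := IHn m (u ^+ 2)%g.
have IE := IHn m.+1 (u * y)%g; rewrite -/A -/B -/E in IA IB IE.
have chiu2 : chi (u ^+ 2)%g ^+ (2 ^ m) = chi u ^+ (2 ^ m.+1).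
  by rewrite expg2 chiM -expr2 -exprM expnS.
rewrite chiu2 in IB; rewrite !chiM !(exprMn (2 ^ m.+1)) in IA IE.
(* The main term satisfies the recursion exactly, because [G m = G m.+1 * D m]; only the three
   earlier errors remain. *)
have -> : 3^-1 * (A + B + E) - chi u ^+ (2 ^ m.+1) * G m.+1 =
  3^-1 * ((A - chi u ^+ (2 ^ m.+1) * chi x ^+ (2 ^ m.+1) * G m.+1)
        + (B - chi u ^+ (2 ^ m.+1) * G m)
        + (E - chi u ^+ (2 ^ m.+1) * chi y ^+ (2 ^ m.+1) * G m.+1)).
  have -> : G m = G m.+1 * D m by rewrite GS divfK.
  by rewrite /D; field.
rewrite normrM normfV normr_nat ler_pdivrMl//.
apply: le_trans (ler_normD _ _) _.
apply: le_trans (lerD (ler_normD _ _) (lexx _)) _.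
apply: le_trans (lerD (lerD IA IB) IE) _.
(* The constants match: [(2 * (5/2) + 1) / 3 = 2 = (4/5) * (5/2)]. *)
rewrite le_eqVlt; apply/orP; left; apply/eqP; rewrite !exprS.
by move: (_ ^+ n) (_ ^+ m) => a b; field.
Qed.

(** * Discrete logarithms and Fourier inversion *)

Lemma order_generator (gT : finGroupType) (x : gT) :
  generator [set: gT] x -> #[x]%g = #|gT|.
Proof. by move=> gx; rewrite /order -(eqP gx) cardsT. Qed.

Lemma generator_exp (gT : finGroupType) (x : gT) :
  generator [set: gT] x -> forall g, exists i, (x ^+ i == g)%g.
Proof.
move=> gx g; have : g \in <[x]>%g by rewrite -(eqP gx) inE.
by case/cycleP=> i ->; exists i.
Qed.

Definition dlog (gT : finGroupType) (x : gT) (gx : generator [set: gT] x)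
    (g : gT) : nat := xchoose (generator_exp gx g).

Lemma dlogK (gT : finGroupType) (x : gT) (gx : generator [set: gT] x) g :
  (x ^+ dlog gx g)%g = g.
Proof. exact/eqP/(xchooseP (generator_exp gx g)). Qed.

Lemma eq_generator_expg (gT : finGroupType) (x : gT) i j :
  generator [set: gT] x ->
  (i == j %[mod #|gT|]) = (x ^+ i == x ^+ j)%g.
Proof. by move=> gx; rewrite eq_expg_mod_order order_generator. Qed.

Lemma dlogM (gT : finGroupType) (x : gT) (gx : generator [set: gT] x) g h :
  dlog gx (g * h)%g = dlog gx g + dlog gx h %[mod #|gT|].
Proof. by apply/eqP; rewrite (eq_generator_expg _ _ gx) expgD !dlogK. Qed.

Lemma dlog_generator (gT : finGroupType) (x : gT)
    (gx : generator [set: gT] x) : dlog gx x = 1 %[mod #|gT|].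
Proof. by apply/eqP; rewrite (eq_generator_expg _ _ gx) dlogK expg1. Qed.

Lemma dlog_inj_mod (gT : finGroupType) (x : gT)
    (gx : generator [set: gT] x) g h :
  dlog gx g = dlog gx h %[mod #|gT|] -> g = h.
Proof. by move/eqP; rewrite (eq_generator_expg _ _ gx) !dlogK => /eqP. Qed.

(** Orthogonality of characters: a geometric sum whose ratio [w ^+ i / w ^+ j] is a [p]-th root of
    unity. *)
Lemma sum_prim_root_delta (K : fieldType) (p : nat) (w : K) (i j : nat) :
  p.-primitive_root w ->
  \sum_(0 <= k < p) (w ^+ (k * j))^-1 * w ^+ (k * i) =
  (p%:R *+ (i == j %[mod p])%N : K).
Proof.
move=> pw; have w0 : w != 0.
  apply/eqP => w0; have := prim_expr_order pw.
  by rewrite w0 expr0n gtn_eqF ?(prim_order_gt0 pw)// => /esym/eqP; rewrite oner_eq0.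
pose q := w ^+ i / w ^+ j.
have -> : \sum_(0 <= k < p) (w ^+ (k * j))^-1 * w ^+ (k * i) =
          \sum_(k < p) q ^+ k.
  rewrite big_mkord; apply: eq_bigr => k _.
  by rewrite /q exprMn exprVn -!exprM mulrC ![(_ * k)%N]mulnC.
rewrite -(eq_prim_root_expr pw).
case: (eqVneq (w ^+ i) (w ^+ j)) => wij.
  have -> : q = 1 by rewrite /q wij divff// expf_neq0.
  rewrite (eq_bigr (fun=> 1)); last by move=> k _; rewrite expr1n.
  by rewrite sumr_const card_ord.
have q1 : q - 1 != 0.
  rewrite subr_eq0; apply: contraNneq wij => q1.
  by rewrite -[w ^+ i](divfK (expf_neq0 j w0)) -/q q1 mul1r.
apply: (mulfI q1); rewrite -subrX1 mulr0n mulr0.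
rewrite /q exprMn exprVn -!exprM ![(_ * p)%N]mulnC !exprM.
by rewrite (prim_expr_order pw) !expr1n invr1 mulr1 subrr.
Qed.

Lemma set_indic1 (K : nzRingType) (gT : finGroupType) (v g : gT) :
  set_indic K [set v] g = (g == v)%:R.
Proof. by rewrite /set_indic in_set1. Qed.

(** Fourier inversion writes [p] times the indicator of [v] as a sum over characters. The trivial
    one gives 1, the others the digit products, and each of the [p] characters adds one truncation
    error. *)
Lemma stopped_mean_near_uniform (R : realType) (gT : finGroupType) (x y : gT)
    (m n : nat) (u v : gT) (p := #|gT|) :
  generator [set: gT] x -> prime p -> odd p ->
  `|p%:R * stopped_mean x y m n (set_indic R [set v]) u - 1| <=
    p%:R * ((4 / 5) ^+ n * (5 / 2) ^+ m) +
    \sum_(1 <= j < p) \prod_(0 <= k < m)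
      flip_weight (2^-1 : R) (4 * (2 ^ k.+1 * j) %/ p).
Proof.
move=> gx pp op; have p0 := prime_gt0 pp.
have pw : p.-primitive_root (cis_root R p) := prim_cis_root R pp op.
set w := cis_root R p in pw; set d : R := _ * (5 / 2) ^+ m.
pose chi k g : R[i] := w ^+ (k * dlog gx g).
have w1 : `|w| = 1.
  by rewrite /w /cis_root /cis normc_def /= cos2Dsin2 sqrtr1.
have chi1 k g : `|chi k g| = 1 by rewrite normrX w1 expr1n.
have w_mod i j k : i = j %[mod p] -> w ^+ (k * i) = w ^+ (k * j).
  move=> ij; apply/eqP; rewrite (eq_prim_root_expr pw).
  by rewrite -modnMmr ij modnMmr.
have chiM k g h : chi k (g * h)%g = chi k g * chi k h.
  by rewrite /chi -exprD -mulnDr; apply: w_mod; exact: dlogM.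
have chix k i : chi k x ^+ i = w ^+ (i * k).
  by rewrite /chi (w_mod _ 1%N)// ?muln1 -?exprM ?[(i * k)%N]mulnC//; exact: dlog_generator.
pose M k : R[i] := stopped_mean x y m n (chi k) u.
have MF : (p%:R * stopped_mean x y m n (set_indic R [set v]) u)%:C%C =
    \sum_(0 <= k < p) (chi k v)^-1 * M k.
  rewrite -stopped_mean_sum rmorphM rmorph_nat rmorph_stopped_mean /=.
  have := @stopped_mean_sum R[i] gT x y unit [:: tt] (fun=> p%:R)
    (fun _ => (real_complex R) \o set_indic R [set v]) m n u.
  rewrite big_seq1 => <-.
  apply: eq_stopped_mean => g.
  rewrite big_seq1 (sum_prim_root_delta _ _ pw) /= set_indic1 rmorph_nat mulr_natr.
  congr (_ *+ nat_of_bool _); apply/eqP/eqP => [->//|].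
  by apply: (@dlog_inj_mod _ _ gx).
pose P k : R[i] := \prod_(0 <= i < m)
  (3 - chi k x ^+ (2 ^ i.+1) - chi k y ^+ (2 ^ i.+1))^-1.
have dC : d%:C%C = (4 / 5) ^+ n * (5 / 2) ^+ m :> R[i].
  by rewrite /d rmorphM !rmorphXn !rmorphM !fmorphV !rmorph_nat.
have MP k : `|M k - chi k u ^+ (2 ^ m) * P k| <= d%:C%C.
  by rewrite dC; apply: stopped_mean_char.
have chi0 g : chi 0%N g = 1 by rewrite /chi mul0n expr0.
have P0 : P 0%N = 1.
  rewrite /P big1// => i _; rewrite !chi0 !expr1n (_ : 3 - 1 - 1 = 1) ?invr1//.
  by ring.
have Pk k : `|P k| <= (\prod_(0 <= i < m)
      flip_weight (2^-1 : R) (4 * (2 ^ i.+1 * k) %/ p))%:C%C.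
  rewrite normr_prod rmorph_prod; apply: ler_prod => i _.
  rewrite normr_ge0 chix /=; apply: norm_cis_root_inv_le => //.
  by rewrite normrX chi1 expr1n.
rewrite -lecR rmorphD rmorphM rmorph_nat rmorph_sum /=.
have -> : (`|p%:R * stopped_mean x y m n (set_indic R [set v]) u - 1|)%:C%C =
    `|\sum_(0 <= k < p) (chi k v)^-1 * M k - 1|.
  rewrite -MF -(rmorph1 (real_complex R)) -rmorphB.
  by rewrite [RHS]normc_def /= expr0n /= addr0 sqrtr_sqr.
rewrite [X in `|X - 1|](big_ltn p0) chi0 invr1 mul1r addrAC.
apply: le_trans (ler_normD _ _) _.
have -> : p%:R = 1 + (p.-1)%:R :> R[i] by rewrite -[1 in RHS]/(1%:R) -natrD add1n prednK.
rewrite mulrDl mul1r -addrA; apply: lerD.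
  by have := MP 0%N; rewrite chi0 expr1n P0 mulr1.
apply: le_trans (ler_norm_sum _ _ _) _.
have -> : (p.-1)%:R * d%:C%C = \sum_(1 <= k < p) d%:C%C.
  by rewrite sumr_const_nat subn1 mulr_natl.
rewrite -big_split; apply: ler_sum => k _ /=.
rewrite normrM normfV chi1 invr1 mul1r.
rewrite -[M k](subrK (chi k u ^+ (2 ^ m) * P k)).
apply: le_trans (ler_normD _ _) _; apply: lerD => //.
by rewrite normrM normrX chi1 expr1n mul1r.
Qed.

(** * Choice of the parameters *)

(** The number [r = 2 s] of windows. With [t = trunc_log 2 p] it ensures [32 r t <= 2 ^ r]: of the
    two factors [2 ^ s], one absorbs [64 t], the other [s]. *)
Definition log_depth (p : nat) : nat := (2 * (trunc_log 2 (trunc_log 2 p) + 7))%N.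

Definition doublings (p : nat) : nat := (log_depth p * trunc_log 2 p)%N.

(** Ten steps per doubling suffice, as [(4/5)^10 * (5/2) <= 1/2]. *)
Definition block_length (p : nat) : nat := (10 * doublings p)%N.

Lemma trunc_log_leq_id t : (trunc_log 2 t <= t)%N.
Proof.
case: t => [|t]; first by rewrite trunc_log0.
by apply: ltnW; apply: leq_trans (ltn_expl _ (ltnSn 1)) _; rewrite trunc_logP.
Qed.

(** This crude bound absorbs the rounding of the number of blocks; it uses [log_depth p <= 16 t] and
    [t^2 <= 2 * 2^t]. *)
Lemma block_length_le p : (1 < p)%N -> (block_length p <= 320 * p)%N.
Proof.
move=> p1; rewrite /block_length /doublings /log_depth; set t := trunc_log 2 p.
have tp : (2 ^ t <= p)%N by apply: trunc_logP => //; exact: ltnW.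
have t1 : (0 < t)%N by rewrite trunc_log_gt0.
have tt : (t * t <= 2 * 2 ^ t)%N.
  elim: t {tp t1} => [//|[//|[//|[//|t]]] IHt].
  by rewrite expnS; move: IHt; move: (2 ^ _)%N => e; nia.
by have := trunc_log_leq_id t; nia.
Qed.

(** Truncation costs at most [1/4] since [4 p <= 2 ^ m]; linearising the power bounds the Fourier
    part by [4 r t / 2 ^ r <= 1/8]. *)
Lemma mixing_error_le (R : realFieldType) p : (2 < p)%N ->
  p%:R * ((4 / 5) ^+ block_length p * (5 / 2) ^+ doublings p) +
  (log_depth p)%:R *
    (2 * (1 + 2^-1 ^+ log_depth p) ^+ trunc_log 2 p - 2) <= 2^-1 :> R.
Proof.
move=> p2; have p1 : (1 < p)%N by exact: ltnW.
rewrite /block_length; set r := log_depth p; set t := trunc_log 2 p.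
set m := doublings p.
have t1 : (0 < t)%N by rewrite trunc_log_gt0.
have pt : (p < 2 ^ t.+1)%N by exact: trunc_log_ltn.
have mE : m = (r * t)%N by [].
have rE : r = (2 * (trunc_log 2 t + 7))%N by [].
have pm : (4 * p <= 2 ^ m)%N.
  apply: (@leq_trans (2 ^ (t.+1 + 2))); first by rewrite expnD; lia.
  by rewrite leq_exp2l//; nia.
have rt : (32 * (r * t) <= 2 ^ r)%N.
  rewrite rE mulnC; set s := (trunc_log 2 t + 7)%N.
  have st : (64 * t <= 2 ^ s)%N.
    have := trunc_log_ltn t (ltnSn 1); rewrite /s expnS expnD.
    by move: (2 ^ _)%N => e; lia.
  have s2 : (s <= 2 ^ s)%N by rewrite ltnW// ltn_expl.
  rewrite mulnC [(2 * s)%N]mulnC expnM -[X in (_ <= X)%N]/(2 ^ s * 2 ^ s)%N.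
  by apply: leq_trans (leq_mul st s2); lia.
have e0 k : 0 < 2^-1 ^+ k :> R by rewrite exprn_gt0// invr_gt0.
have eK k : 2^-1 ^+ k * (2 ^ k)%:R = 1 :> R.
  by rewrite natrX -exprMn mulVf ?expr1n// pnatr_eq0.
have small : p%:R * ((4 / 5) ^+ (10 * m) * (5 / 2) ^+ m) <= 4^-1 :> R.
  apply: (@le_trans _ _ (p%:R * 2^-1 ^+ m)).
    rewrite ler_wpM2l// exprM -exprMn; apply: lerXn2r; rewrite ?nnegrE.
    - by rewrite mulr_ge0 ?exprn_ge0 ?divr_ge0.
    - by rewrite invr_ge0.
    - by rewrite !exprS expr0; lra.
  have pmR : (4 * p)%:R <= (2 ^ m)%:R :> R by rewrite ler_nat.
  by rewrite -(ler_pM2l (e0 m)) eK natrM in pmR; lra.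
have rtR : 32 * (r%:R * t%:R) * 2^-1 ^+ r <= 1 :> R.
  by rewrite -[leRHS](eK r) mulrC ler_pM2l// -!natrM ler_nat.
have tR : 2 * t%:R * 2^-1 ^+ r <= 1 :> R.
  apply: le_trans rtR; rewrite ler_pM2r// -!natrM ler_nat.
  by rewrite rE; nia.
have := expr1D_le (ltW (e0 r)) tR; set X := _ ^+ t => HX.
have : r%:R * (2 * X - 2) <= r%:R * (4 * t%:R * 2^-1 ^+ r) :> R.
  by rewrite ler_wpM2l//; lra.
by lra.
Qed.

(** Each point has mass within [1 / (2 p)] of [1 / p]; the masses are summed over [S]. *)
Lemma stopped_mean_set_ge (R : realType) (gT : finGroupType) (x y : gT)
    (S : {set gT}) u (p := #|gT|) :
  generator [set: gT] x -> prime p -> odd p ->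
  #|S|%:R / (2 * p%:R) <=
    stopped_mean x y (doublings p) (block_length p) (set_indic R S) u.
Proof.
move=> gx pp op; have p0 := prime_gt0 pp.
have p2 : (2 < p)%N := odd_prime_gt2 op pp.
have pR : 0 < p%:R :> R by rewrite ltr0n.
have point v : (2 * p%:R)^-1 <=
    stopped_mean x y (doublings p) (block_length p) (set_indic R [set v]) u.
  have := stopped_mean_near_uniform R y (doublings p) (block_length p) u v gx pp op.
  have : (0 < log_depth p)%N by rewrite /log_depth; lia.
  move/(sum_orbit_le R op (trunc_log_ltn p (ltnSn 1))) => orb near.
  have := le_trans near (le_trans (lerD (lexx _) orb) (mixing_error_le R p2)).
  rewrite ler_norml => /andP[+ _].
  by rewrite invfM ler_pdivrMr// mulrC; lra.
have -> : stopped_mean x y (doublings p) (block_length p) (set_indic R S) u =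
    \sum_(v <- enum S) 1 *
      stopped_mean x y (doublings p) (block_length p) (set_indic R [set v]) u.
  rewrite -stopped_mean_sum; apply: eq_stopped_mean => g.
  rewrite big_enum /= (eq_bigr (fun v => (g == v)%:R)); last first.
    by move=> v _; rewrite mul1r set_indic1.
  rewrite /set_indic; case: (boolP (g \in S)) => gS.
    rewrite (bigD1 g)//= eqxx big1 ?addr0// => v /andP[_ vg].
    by rewrite eq_sym (negbTE vg).
  by rewrite big1// => v vS; case: eqP => // gv; rewrite gv vS in gS.
have -> : #|S|%:R / (2 * p%:R) = \sum_(v <- enum S) (2 * p%:R)^-1 :> R.
  by rewrite big_enum sumr_const mulr_natl.
by apply: ler_sum => v _; rewrite mul1r.
Qed.

Lemma ln3_gt1 (R : realType) : 1 < ln 3 :> R.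
Proof.
(* From [1 - 1/6 <= exp (-1/6)] it follows that [e <= (6/5)^6 < 3]. *)
have e6 : expR (6^-1 : R) <= 6 / 5.
  rewrite -[X in expR X]opprK expRN -[6 / 5]invrK lef_pV2 ?posrE ?expR_gt0//.
    by apply: le_trans (expR_ge1Dx _); lra.
  by lra.
have e1 : expR (1 : R) = expR 6^-1 ^+ 6.
  by rewrite -expRM_natl; congr expR; lra.
rewrite -ltr_expR lnK ?posrE// e1.
apply: le_lt_trans (_ : (6 / 5) ^+ 6 < _); last by rewrite !exprS expr0; lra.
by apply: lerXn2r; rewrite ?nnegrE ?expR_ge0//; lra.
Qed.

(** The additive constants of the change of base, collected in [c], become a factor because
    [ln (ln p) >= b > 0]. *)
Lemma block_length_ln_bound (R : realType) :
  exists2 D : R, 0 < D & forall p, (2 < p)%N ->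
    (block_length p)%:R <= D * (ln p%:R * ln (ln p%:R)).
Proof.
pose a : R := ln 2; have a0 : 0 < a by rewrite ln_gt0// ltr1n.
pose b : R := ln (ln 3); have b0 : 0 < b by rewrite ln_gt0// ln3_gt1.
pose c : R := `|7 * a - ln a|.
exists (20 * (1 + c / b) / a ^+ 2).
  rewrite divr_gt0 ?exprn_gt0// mulr_gt0// ltr_pwDl//.
  by rewrite divr_ge0 ?normr_ge0// ltW.
move=> p p2; have p1 : (1 < p)%N by exact: ltnW.
rewrite /block_length /doublings /log_depth.
set t := trunc_log 2 p; set l := trunc_log 2 t.
have t1 : (0 < t)%N by rewrite trunc_log_gt0.
set L : R := ln p%:R.
have L3 : ln 3 <= L by rewrite ler_ln ?posrE ?ltr0n ?ler_nat//; lia.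
have L0 : 0 < L by apply: lt_le_trans L3; apply: lt_trans (ln3_gt1 R).
have Lb : b <= ln L by rewrite ler_ln ?posrE// (lt_trans ltr01) ?ln3_gt1.
have ln2X k q : (0 < q)%N -> (2 ^ k <= q)%N -> k%:R * a <= ln q%:R.
  move=> q0 kq; rewrite /a mulr_natl -lnXn ?ltr0n//.
  by rewrite ler_ln ?posrE ?exprn_gt0 ?ltr0n// -natrX ler_nat.
have ta : t%:R * a <= L by apply: ln2X; [exact: ltnW|exact: trunc_logP (ltnW p1)].
have la : l%:R * a <= ln L - ln a.
  apply: le_trans (ln2X l t t1 (trunc_logP _ t1)) _ => //.
  rewrite lerBrDr -lnM ?posrE ?ltr0n// ler_ln ?posrE ?mulr_gt0 ?ltr0n//.
have lna : ln L - ln a + 7 * a <= ln L * (1 + c / b).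
  have : 7 * a - ln a <= c by exact: ler_norm.
  have : c <= ln L * (c / b).
    by rewrite mulrCA ler_peMr ?normr_ge0// ler_pdivlMr// mul1r.
  by rewrite mulrDr mulr1; lra.
have l7a : (l%:R + 7) * a <= ln L * (1 + c / b) by rewrite mulrDl; lra.
rewrite mulrAC ler_pdivlMr ?exprn_gt0// !natrM natrD.
have := ler_pM _ _ ta l7a.
rewrite !mulr_ge0 ?ler0n ?(ltW a0) ?addr_ge0 ?ler0n// => /(_ isT isT) H.
by rewrite expr2; lra.
Qed.

Theorem mainTheorem1 (R : realType) (eps : R) (eps_gt0 : 0 < eps)
    (eps_lt1 : eps < 1) :
  exists C : R,
    forall (gT : finGroupType) (x y g0 : gT),
      cyclic [set: gT] -> prime #|gT| -> odd #|gT| ->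
      generator [set: gT] x ->
      1 - eps <=
        labelling_prob R
          (collision_within x y g0
             (C * Num.sqrt (#|gT|%:R * ln #|gT|%:R * ln (ln #|gT|%:R)))).
Proof.
have [D D0 tauD] := block_length_ln_bound R.
(* The first summand pays for [2 q n], the second for rounding [q] up to [k]. *)
pose c : R := 2 * Num.sqrt (2 / eps) + 2 * Num.sqrt 320.
exists (c * Num.sqrt D) => gT x y g0 _ pp op gx; set p := #|gT| in pp op *.
have p0 := prime_gt0 pp; have p2 : (2 < p)%N := odd_prime_gt2 op pp.
have pR : 0 < p%:R :> R by rewrite ltr0n.
set n := block_length p.
have n0 : (0 < n)%N.
  rewrite /n /block_length /doublings /log_depth !muln_gt0 /= trunc_log_gt0.
  by rewrite addn_gt0 orbT /= ltnW.
have nR : 0 < n%:R :> R by rewrite ltr0n.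
(* Chosen so that [k >= q] yields [k h = k^2 n / (2 p) >= 1 / eps]. *)
pose q : R := Num.sqrt (2 / eps * p%:R / n%:R).
pose k := (Num.truncn q).+1.
have q0 : 0 <= q by exact: sqrtr_ge0.
have /andP[kq qk] : k%:R - 1 <= q < k%:R.
  by have := truncn_itv q0; rewrite -/k -natr1 addrK.
have qn2 : q ^+ 2 * n%:R = 2 / eps * p%:R.
  rewrite sqr_sqrtr; first by rewrite divfK// gt_eqF.
  by rewrite !mulr_ge0 ?invr_ge0 ?ler0n// ltW.
have nE : n%:R = Num.sqrt (n%:R ^+ 2) :> R by rewrite sqrtr_sqr ger0_norm.
have steps : (k * n + k * n)%:R <= c * Num.sqrt (p%:R * n%:R).
  have qn : q * n%:R = Num.sqrt (2 / eps) * Num.sqrt (p%:R * n%:R).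
    have e0 : 0 <= 2 / eps by rewrite divr_ge0// ltW.
    rewrite -sqrtrM// [X in _ * X]nE /q -sqrtrM.
      by congr Num.sqrt; field; rewrite !gt_eqF.
    by rewrite !mulr_ge0 ?invr_ge0 ?ler0n// ltW.
  have nn : n%:R <= Num.sqrt 320 * Num.sqrt (p%:R * n%:R) :> R.
    rewrite -sqrtrM// [leLHS]nE ler_wsqrtr//.
    rewrite expr2 mulrA ler_pM2r// -natrM ler_nat.
    by apply: block_length_le; exact: ltnW.
  have -> : (k * n + k * n)%:R = 2 * (k%:R * n%:R) :> R by rewrite natrD natrM; ring.
  have : k%:R * n%:R <= (q + 1) * n%:R by rewrite ler_pM2r//; lra.
  rewrite mulrDl mul1r qn /c mulrDl; lra.
(* The first [k * n] steps fill the visited set; the next [k * n] form [k] blocks that may hit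
   it. *)
apply: le_trans (collision_within_prob_ge x y g0 (n := (k * n + k * n)%N) _);
  last first.
  apply: le_trans steps _; rewrite -mulrA ler_wpM2l//.
    by rewrite addr_ge0// mulr_ge0// sqrtr_ge0.
  rewrite -sqrtrM ?(ltW D0)// ler_wsqrtr// -!mulrA mulrCA ler_pM2l//.
  exact: tauD.
rewrite lerD2l lerN2; pose h : R := (k * n)%:R / (2 * p%:R).
have h0 : 0 <= h by rewrite divr_ge0 ?mulr_ge0 ?ler0n.
have hS (S : {set gT}) u : (k * n <= #|S|)%N ->
    h <= stopped_mean x y (doublings p) n (set_indic R S) u.
  move=> NS; apply: le_trans (stopped_mean_set_ge R y S u gx pp op).
  by rewrite ler_pM2r ?ler_nat// invr_gt0 mulr_gt0.
have b0 : 0 <= (1 + k%:R * h)^-1 by rewrite invr_ge0 addr_ge0// mulr_ge0.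
apply: le_trans (fresh_prob_prefix b0 (fresh_prob_iter h0 hS k) g0 _) _.
  by rewrite cards0.
have kh : eps^-1 <= k%:R * h.
  rewrite /h natrM mulrA ler_pdivlMr ?mulr_gt0//.
  have -> : eps^-1 * (2 * p%:R) = 2 / eps * p%:R by ring.
  rewrite -qn2 mulrA ler_pM2r// expr2 ler_pM//; exact: ltW.
rewrite -[leRHS]invrK lef_pV2 ?posrE ?invr_gt0//; last first.
  by rewrite ltr_pwDl// mulr_ge0.
by apply: le_trans kh _; rewrite lerDr.
Qed.
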